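(* Let $\mathbf{End}_{\mathbb{R}^+}$ be the set of all endomorphisms of the monoid $(\mathbb{R}^+, \vee)$ and let $\mathbf{P}_{\mathbf{PU}}$ be the set of all pseudoultrametric-preserving functions $\mathbb{R}^+ \to \mathbb{R}^+$. Then $$\mathbf{End}_{\mathbb{R}^+} = \mathbf{P}_{\mathbf{PU}}.$$
   Context: $\mathbb{R}^+ = [0,\infty)$. The operation $\vee$ on $\mathbb{R}^+$ is $x \vee y = \max\{x,y\}$; $(\mathbb{R}^+, \vee)$ is a monoid with identity element $1_{\mathbb{R}^+} = 0$. An endomorphism of a monoid $(S,\ast,1_S)$ is a mapping $\Phi : S \to S$ with $\Phi(x \ast y) = \Phi(x) \ast \Phi(y)$ for all $x,y \in S$ and $\Phi(1_S) = 1_S$. A pseudoultrametric on a nonempty set $X$ is a function $d : X \times X \to \mathbb{R}^+$ such that $d(x,x)=0$, $d(x,y)=d(y,x)$ and $d(x,y) \leqslant \max\{d(x,z), d(z,y)\}$ for all $x,y,z \in X$; then $(X,d)$ is called a pseudoultrametric space. A function $f : \mathbb{R}^+ \to \mathbb{R}^+$ is pseudoultrametric-preserving if $f \circ d$ (the mapping $(x,y) \mapsto f(d(x,y))$) is a pseudoultrametric on $X$ for every pseudoultrametric space $(X,d)$. *)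

(* Defs.v *)
From HB Require Import structures.
From mathcomp Require Import all_boot all_order all_algebra.
From mathcomp Require Import all_classical interval_inference reals.

Set Implicit Arguments.
Unset Strict Implicit.
Unset Printing Implicit Defensive.

Import Order.TTheory GRing.Theory Num.Theory.

Local Open Scope ring_scope.
Local Open Scope classical_set_scope.

(* An alias of [{nonneg R}] that carries the monoid law "max", so that this law
   is attached to the alias only. *)
Definition max_monoid (R : realType) : Type := {nonneg R}.

HB.instance Definition _ (R : realType) := Choice.on (max_monoid R).

Section MaxMonoid.
Variable R : realType.

Definition nng_max (x y : max_monoid R) : max_monoid R :=
  Order.max (x : {nonneg R}) (y : {nonneg R}).
Definition nng_zero : max_monoid R := 0%:nng.

Fact nng_maxA : associative nng_max.
Proof. by move=> x y z; exact: maxA. Qed.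

Fact nng_max0x : left_id nng_zero nng_max.
Proof. by move=> x; apply: max_r; rewrite -num_le /= ge0. Qed.

Fact nng_maxx0 : right_id nng_zero nng_max.
Proof. by move=> x; apply: max_l; rewrite -num_le /= ge0. Qed.

HB.instance Definition _ :=
  isMonoid.Build (max_monoid R) nng_maxA nng_max0x nng_maxx0.

End MaxMonoid.

(* The qualified name avoids the homonym for rings exported by [GRing.Theory]. *)
Definition End_Rplus (R : realType) : set ({nonneg R} -> {nonneg R}) :=
  [set Phi | monoid.monoid_morphism (Phi : max_monoid R -> max_monoid R)].
Arguments End_Rplus R : clear implicits.

Record pseudoultrametric (R : realType) (X : Type) (d : X -> X -> {nonneg R}) :
    Prop := Pseudoultrametric {
  pum_xx : forall x, d x x = 0%:nng ;
  pum_sym : forall x y, d x y = d y x ;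
  pum_tri : forall x y z, d x y <= Order.max (d x z) (d z y) }.

Definition pseudoultrametric_preserving (R : realType)
    (f : {nonneg R} -> {nonneg R}) : Prop :=
  forall X : Type, inhabited X ->
  forall d : X -> X -> {nonneg R},
    pseudoultrametric d -> pseudoultrametric (fun x y => f (d x y)).

Definition P_PU (R : realType) : set ({nonneg R} -> {nonneg R}) :=
  [set f | pseudoultrametric_preserving f].
Arguments P_PU R : clear implicits.

(* Main.v *)
(** Both sets consist of the nondecreasing functions vanishing at [0]. For
    [f] in [P_PU], monotonicity comes from the ultrametric equal to
    [max x y] off the diagonal: if [a < b], the triangle [0, a, b] has sides
    [a, b, b], so the strong triangle inequality for [f \o d] reads
    [f a <= f b]. *)


Require Import Defs.
From mathcomp Require Import all_boot all_order all_algebra.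
From mathcomp Require Import all_classical reals.
From mathcomp Require Import interval_inference.

Import Order.TTheory GRing.Theory Num.Theory.

Local Open Scope ring_scope.

Lemma nng_ge0 (R : realType) (x : {nonneg R}) : 0%:nng <= x.
Proof. by rewrite -num_le /= ge0. Qed.

Lemma End_RplusP (R : realType) (f : {nonneg R} -> {nonneg R}) :
  End_Rplus R f <-> f 0%:nng = 0%:nng /\ {homo f : x y / x <= y}.
Proof.
split=> [[f0 fM]|[f0 fh]].
  (* Here [x <= y] is read as [max x y = y], so [f y = max (f x) (f y)] bounds [f x]. *)
  split=> [|x y /max_r xy]; first exact: f0.
  have fmax : f (Order.max x y) = Order.max (f x) (f y) := fM x y.
  by rewrite -xy fmax le_max lexx.
split=> [|x y]; first exact: f0.
(* The monoid law of [max_monoid R] unfolds to [Order.max]. *)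
change (f (Order.max x y) = Order.max (f x) (f y)).
by case: (leP x y) => [/fh/max_r ->|/ltW/fh/max_l ->].
Qed.

Definition max_dist (R : realType) (x y : {nonneg R}) : {nonneg R} :=
  if x == y then 0%:nng else Order.max x y.

Lemma max_dist_pseudoultrametric (R : realType) :
  pseudoultrametric (@max_dist R).
Proof.
split=> [x|x y|x y z]; rewrite /max_dist.
- by rewrite eqxx.
- by rewrite eq_sym maxC.
- have [_|xy] := eqVneq x y; first exact: nng_ge0.
  (* If [z] is an endpoint, one of the two sides is [max x y] itself; otherwise [x <= max x z] and
     [y <= max z y]. *)
  have [<-|_] := eqVneq x z; first by rewrite (negPf xy) le_max lexx orbT.
  have [->|_] := eqVneq z y; first by rewrite le_max lexx.
  by rewrite ge_max !le_max !lexx !orbT.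
Qed.

Lemma P_PUP (R : realType) (f : {nonneg R} -> {nonneg R}) :
  P_PU R f <-> f 0%:nng = 0%:nng /\ {homo f : x y / x <= y}.
Proof.
split=> [fP|[f0 fh] X _ d [dxx dC dtri]].
  have [fd0 _ fdtri] := fP _ (inhabits (nng_zero R)) _ (max_dist_pseudoultrametric R).
  pose o : {nonneg R} := nng_zero R.
  (* Every [x] is thus a distance from [o]; at [x = o] the diagonal value [0] agrees with it. *)
  have d0 x : max_dist R o x = x.
    by rewrite /max_dist; case: eqVneq => // _; apply: max_r; exact: nng_ge0.
  have f0 : f o = o by rewrite -{1}(d0 o) fd0.
  split=> // a b; rewrite le_eqVlt => /predU1P[-> //|ab].
  have := fdtri o a b; cbv beta.
  by rewrite !d0 /max_dist (gt_eqF ab) (max_l (ltW ab)) maxxx.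
split=> [x|x y|x y z]; first by rewrite dxx.
- by rewrite dC.
- apply: le_trans (fh _ _ (dtri x y z)) _.
  by case: (leP (d x z) (d z y)) => _; rewrite le_max lexx ?orbT.
Qed.

Theorem theorem3p2 (R : realType) : End_Rplus R = P_PU R.
Proof. by apply/seteqP; split=> f; rewrite End_RplusP P_PUP. Qed.
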